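(* Let $f:[0,1]\to[0,1]$ and $g:[0,1]\to[0,1]$ be Darboux Baire-1 functions. Then $f\circ g$ has a fixed point, i.e. there exists $x\in[0,1]$ with $f(g(x))=x$.
   Context: A function $f:[0,1]\to[0,1]$ is Darboux if it has the intermediate value property (the image of every interval is an interval or a single point). It is Baire-1 if it is the pointwise limit of a sequence of continuous real-valued functions on $[0,1]$. A Darboux Baire-1 function is one having both properties. *)

(* Defs.v *)
From HB Require Import structures.
From mathcomp Require Import all_boot all_order all_algebra.
From mathcomp Require Import all_classical all_reals all_analysis.

Set Implicit Arguments.
Unset Strict Implicit.
Unset Printing Implicit Defensive.

Import Order.TTheory GRing.Theory Num.Theory.
Import numFieldNormedType.Exports.

Local Open Scope classical_set_scope.
Local Open Scope ring_scope.

(* Functions on D are represented by total functions R -> R; only the values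
   on D are constrained. [is_interval] means order-convex: over a realType,
   such sets are the intervals of any kind, the singletons and the empty set. *)
Definition darboux (R : realType) (D : set R) (f : R -> R) : Prop :=
  forall I : set R, is_interval I -> I `<=` D -> is_interval (f @` I).

Definition baire1 (R : realType) (D : set R) (f : R -> R) : Prop :=
  exists h : nat -> R -> R,
    (forall n, {within D, continuous (h n)}) /\
    (forall x, D x -> h n x @[n --> \oo] --> f x).

Definition darboux_baire1 (R : realType) (D : set R) (f : R -> R) : Prop :=
  darboux D f /\ baire1 D f.

(* Main.v *)
(** A fixed point of [f \o g] is a zero of [(x, y) |-> (f y - x, g x - y)] on the
    unit square. This map is wild, but along a vertical edge its second
    component changes sign only once, at [y = g x], and along a horizontal edge
    its first component changes sign only once, at [x = f y]. Hence, if there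
    is no fixed point, its winding number mod 2 around the boundary of a
    rectangle makes sense; it is additive under subdivision and equals 1 on the
    unit square.

    Let [h n --> g] with [h n] continuous. A rectangle of winding number 1
    contains another one that misses the closed set where
    [h n x <= y - 1/(m+1)] for all [n >= m]: on a thin rectangle this set lies
    over a closed [K] on which [g] stays below the rectangle, and if the
    winding number vanished over every interval avoiding [K], the Darboux
    property (values of [g] near a point of [K] recur on both sides of it)
    would make it vanish altogether. Doing this for all [m], both signs and
    both functions gives nested rectangles with a common point, at which
    [y = g x] and [x = f y]. *)

Require Import Defs.
From HB Require Import structures.
From mathcomp Require Import all_boot all_order all_algebra.
From mathcomp Require Import all_classical all_reals all_analysis.
From mathcomp Require Import lra.

Import Order.TTheory GRing.Theory Num.Theory.
Import numFieldNormedType.Exports.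

Local Open Scope classical_set_scope.
Local Open Scope ring_scope.

(** * Closed subsets of the line and their gaps *)

Lemma closed_last_before {R : realType} {K : set R} {x k : R} :
  closed K -> K k -> k <= x ->
  exists l, [/\ K l, k <= l, l <= x & forall z, l < z -> z <= x -> ~ K z].
Proof.
move=> cK Kk kx; pose L := K `&` [set` `]-oo, x]].
have Lk : L k by split=> //=; rewrite in_itv.
have supL : has_sup L.
  by split; [exists k | exists x => z [_ /=]; rewrite in_itv].
have [Ks sx] : L (sup L).
  have: closed L by apply: closedI => //; exact: interval_closed.
  by move/closure_id => {1}->; apply: closure_sup => //; case: supL.
exists (sup L); split=> //.
  exact: ub_le_sup supL.2 _ Lk.
move=> z lz zx Kz; move: lz; rewrite ltNge => /negP; apply.
by apply: ub_le_sup supL.2 _ _; split=> //=; rewrite in_itv.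
Qed.

Lemma closed_first_after {R : realType} {K : set R} {x k : R} :
  closed K -> K k -> x <= k ->
  exists r, [/\ K r, x <= r, r <= k & forall z, x <= z -> z < r -> ~ K z].
Proof.
move=> cK Kk xk.
have cK' : closed (-%R @^-1` K : set R).
  by apply: closed_comp cK => z _; exact: opp_continuous.
have [||l [Kl kl lx Hl]] := @closed_last_before _ _ (- x) (- k) cK'.
- by rewrite /preimage /= opprK.
- by rewrite lerN2.
exists (- l); split=> //; first by rewrite lerNr.
  by rewrite lerNl.
move=> z xz zl Kz; apply: (Hl (- z)); rewrite ?lerN2 //; first by rewrite ltrNr.
by rewrite /preimage /= opprK.
Qed.

(* [K] is where the second component is bounded away from [0] on one side, [N]
   where it has that strict sign, [u] and [w] are the sign changes of the first
   component along the two horizontal edges, and [psi a (+) psi b] is the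
   winding number over [[a, b]]. A gap of [K] carries no winding, so it contains
   both or none of the effective points among [u] and [w]. *)
Section ConstantAcrossGaps.
Context {R : realType} {A B : R} {K N : set R} {psi : R -> bool}.
Context {u w : R} {e1 e2 : bool}.
Hypothesis cK : closed K.
Hypothesis KAB : forall x, K x -> A <= x <= B.
Hypothesis KN : K `<=` N.
Hypothesis KNl : forall k x, K k -> A <= x -> x < k ->
  exists z, [/\ x < z, z < k & N z].
Hypothesis KNr : forall k x, K k -> x <= B -> k < x ->
  exists z, [/\ k < z, z < x & N z].
Hypothesis psiN : forall a b, A <= a -> b <= B -> a < b -> N a -> N b ->
  psi a (+) psi b = (e1 && (a < u < b)) (+) (e2 && (a < w < b)).
Hypothesis e1N : e1 -> ~ N u.
Hypothesis e2N : e2 -> ~ N w.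
Hypothesis psi_free : forall a b, A <= a -> b <= B -> a < b ->
  (forall x, a <= x <= b -> ~ K x) -> psi a = psi b.

Let addb_eq (a b : bool) : a (+) b = false -> a = b.
Proof. by case: a b => -[]. Qed.

(** [N] recurs just to the right of [k], so some [z] in [N] comes before any of [u], [w] that lie
    beyond [k]. Then [psiN] sees no change from [k] to [z], and [psi_free] covers the rest. *)
Let psi_right k x : K k -> k <= x -> x <= B ->
  (forall z, k < z -> z <= x -> ~ K z) -> psi k = psi x.
Proof.
move=> Kk; rewrite le_eqVlt => /predU1P[->//|kx] xB kfree.
have /andP[Ak _] := KAB k Kk.
(* No [z] between [k] and [far t] has [t] strictly between [k] and itself. *)
pose far t := if k < t then Num.min t x else x.
have farP t : [/\ k < far t, far t <= x & k < t -> far t <= t].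
  rewrite /far; case: ifPn => kt; split=> //; rewrite ?lt_min ?kt //.
  - by rewrite ge_min lexx orbT.
  - by rewrite ge_min lexx.
have [[k1 x1 u1] [k2 x2 u2]] := (farP u, farP w).
have [||z [kz zy Nz]] := KNr k (Num.min (far u) (far w)) Kk.
- by rewrite ge_min (le_trans x1).
- by rewrite lt_min k1.
move: zy; rewrite lt_min => /andP[zu zw].
have zx := lt_le_trans zu x1.
have zB := le_trans (ltW zx) xB.
have gap t : z < far t -> (k < t -> far t <= t) -> (k < t < z) = false.
  move=> zt; case: (ltP k t) => //= kt /(_ isT) tt.
  by apply/negbTE; rewrite -leNgt (le_trans (ltW zt)).
have -> : psi k = psi z.
  apply: addb_eq; rewrite psiN //; [|exact: KN].
  by rewrite !gap // !andbF.
apply: psi_free => //; first exact: le_trans (ltW kz).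
by move=> y /andP[zy yx]; apply: kfree => //; exact: lt_le_trans zy.
Qed.

Let psi_left k x : K k -> x <= k -> A <= x ->
  (forall z, x <= z -> z < k -> ~ K z) -> psi x = psi k.
Proof.
move=> Kk; rewrite le_eqVlt => /predU1P[->//|xk] Ax kfree.
have /andP[_ kB] := KAB k Kk.
pose far t := if t < k then Num.max t x else x.
have farP t : [/\ far t < k, x <= far t & t < k -> t <= far t].
  rewrite /far; case: ifPn => kt; split=> //; rewrite ?gt_max ?kt //.
  - by rewrite le_max lexx orbT.
  - by rewrite le_max lexx.
have [[k1 x1 u1] [k2 x2 u2]] := (farP u, farP w).
have [||z [yz zk Nz]] := KNl k (Num.max (far u) (far w)) Kk.
- by rewrite le_max (le_trans Ax).
- by rewrite gt_max k1.
move: yz; rewrite gt_max => /andP[zu zw].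
have xz := le_lt_trans x1 zu.
have Az := le_trans Ax (ltW xz).
have gap t : far t < z -> (t < k -> t <= far t) -> (z < t < k) = false.
  move=> zt; case: (ltP t k) => [kt /(_ isT) tt|]; last by rewrite andbF.
  by rewrite andbT; apply/negbTE; rewrite -leNgt (le_trans _ (ltW zt)).
have <- : psi z = psi k.
  apply: addb_eq; rewrite psiN //; [|exact: KN].
  by rewrite !gap // !andbF.
apply: psi_free => //; first exact: le_trans (ltW zk) kB.
by move=> y /andP[xy yz]; apply: kfree => //; exact: le_lt_trans zk.
Qed.

(** Take the maximal gap around [t]: [psi] takes the value [psi t] at both its ends, so the two
    terms of [psiN] cancel. *)
Let psi_gap k k' t : K k -> K k' -> k < t -> t < k' -> ~ K t ->
  exists l r, [/\ k <= l, l < t, t < r, r <= k' &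
    (e1 && (l < u < r)) = (e2 && (l < w < r))].
Proof.
move=> Kk Kk' kt tk' Kt.
have [l [Kl kl lt lfree]] := closed_last_before cK Kk (ltW kt).
have [r [Kr tr rk' rfree]] := closed_first_after cK Kk' (ltW tk').
have {}lt : l < t.
  by rewrite lt_neqAle lt andbT; apply/eqP => E; apply: Kt; rewrite -E.
have {}tr : t < r.
  by rewrite lt_neqAle tr andbT; apply/eqP => E; apply: Kt; rewrite E.
have /andP[Al _] := KAB l Kl; have /andP[_ rB] := KAB r Kr.
exists l, r; split=> //; apply: addb_eq.
rewrite -psiN ?(lt_trans lt) //; [|exact: KN..].
rewrite (psi_right l t) ?ltW // ?(lt_le_trans tr) // ?(psi_left r t) ?addbb //.
  exact: ltW.
by rewrite (le_trans Al) // ltW.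
Qed.

(** An effective sign change is outside [N], hence in a gap of [K]; that gap holds the other
    effective one too, and the two cancel. *)
Let psi_K k k' : K k -> K k' -> k < k' -> psi k = psi k'.
Proof.
move=> Kk Kk' kk'.
have /andP[Ak _] := KAB k Kk; have /andP[_ kB] := KAB k' Kk'.
apply: addb_eq; rewrite psiN //; [|exact: KN..].
have [/andP[E1 /andP[ku uk]]|nu] := boolP (e1 && _).
  have [|l [r [kl lu ur rk]]] := psi_gap k k' u Kk Kk' ku uk.
    by move=> /KN; exact: e1N.
  rewrite E1 lu ur /= => /esym/andP[-> /andP[lw wr]].
  by rewrite (le_lt_trans kl) // (lt_le_trans wr).
have [/andP[E2 /andP[kw wk]]|//] := boolP (e2 && _).
have [|l [r [kl lw wr rk]]] := psi_gap k k' w Kk Kk' kw wk.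
  by move=> /KN; exact: e2N.
rewrite E2 lw wr /= => /andP[E1 /andP[lu ur]]; move: nu.
by rewrite E1 (le_lt_trans kl) // (lt_le_trans ur).
Qed.

Lemma constant_across_gaps : A < B -> psi A = psi B.
Proof.
move=> AB; have [[k Kk]|noK] := pselect (exists k, K k); last first.
  by apply: psi_free => // x _ Kx; apply: noK; exists x.
have /andP[Ak kB] := KAB k Kk.
have [l [Kl Al lk lfree]] := closed_first_after cK Kk Ak.
have [r [Kr kr rB rfree]] := closed_last_before cK Kk kB.
rewrite (psi_left l A) // -(psi_right r B) //.
have [->//|lr] := eqVneq l r.
by apply: psi_K => //; rewrite lt_neqAle lr (le_trans lk).
Qed.

End ConstantAcrossGaps.

(** * Consequences of continuity and of the Darboux property *)

Lemma closed_within_preimage {T U : topologicalType} {D : set T} {h : T -> U}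
    {V : set U} :
  closed D -> {within D, continuous h} -> closed V -> closed (D `&` h @^-1` V).
Proof.
by move=> cD /continuous_closedP hc /hc; rewrite closed_setSI.
Qed.

Definition beyond {R : realType} (s : bool) (v : R) (j : R * R) :=
  if s then j.2 < v else v < j.1.

(** If [p x] is not beyond [j], the value halfway between [p k] and the endpoint of [j] facing it is
    attained. It is still beyond [j], and it differs from [p k], so it is attained away from [k]. *)
Lemma darboux_beyond {R : realType} {D J : set R} {p : R -> R} {s : bool}
    {j : R * R} {k x : R} :
  darboux D p -> is_interval J -> J `<=` D -> J k -> J x -> x != k ->
  beyond s (p k) j -> exists z, [/\ J z, z != k & beyond s (p z) j].
Proof.
move=> dp iJ JD Jk Jx xk bk; have [bx|] := boolP (beyond s (p x) j).
  by exists x.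
have im := dp J iJ JD; rewrite /beyond in bk *.
case: s bk => bk; rewrite -leNgt => bx.
  have [|z Jz pz] :=
    im _ _ (imageP p Jx) (imageP p Jk) ((p k + j.2) / 2).
    by apply/andP; split; lra.
  exists z; split=> //; last by rewrite pz; lra.
  by apply/eqP => zk; move: pz; rewrite zk; lra.
have [|z Jz pz] := im _ _ (imageP p Jk) (imageP p Jx) ((p k + j.1) / 2).
  by apply/andP; split; lra.
exists z; split=> //; last by rewrite pz; lra.
by apply/eqP => zk; move: pz; rewrite zk; lra.
Qed.

(** * The mod 2 index of a rectangle *)

(** A sum over the four corners: shared corners cancel, which makes it additive under
    subdivision. *)
Definition index {R : realType} (P : R -> R -> bool) (i j : R * R) : bool :=
  P i.1 j.1 (+) P i.2 j.1 (+) (P i.1 j.2 (+) P i.2 j.2).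

Lemma index_transpose {R : realType} (P : R -> R -> bool) (i j : R * R) :
  index (fun y x => P x y) j i = index P i j.
Proof. by rewrite /index addbACA. Qed.

Definition nested {R : realType} (i j : R * R) :=
  [&& j.1 <= i.1, i.1 < i.2 & i.2 <= j.2].

Lemma nested_trans {R : realType} {i j k : R * R} :
  nested i j -> nested j k -> nested i k.
Proof.
move=> /and3P[ji ii ij] /and3P[kj jj jk].
by rewrite /nested ii (le_trans kj) // (le_trans ij).
Qed.

Lemma index_thin {R : realType} {P : R -> R -> bool} {i j : R * R} {e : R} :
  0 < e -> j.1 < j.2 -> index P i j ->
  exists j', [/\ nested j' j, j'.2 - j'.1 < e & index P i j'].
Proof.
move=> e0 jj Pij; have dj : 0 < j.2 - j.1 by rewrite subr_gt0.
have bisect n : exists j', [/\ nested j' j,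
    j'.2 - j'.1 = (j.2 - j.1) * (1 / 2 ^+ n) & index P i j'].
  elim: n => [|n [[c d] [/and3P[/= jc cd dj'] len Pcd]]].
    by exists j; rewrite expr0 divr1 mulr1 /nested !lexx jj.
  have len' : (j.2 - j.1) * (1 / 2 ^+ n.+1) = (d - c) / 2.
    by rewrite exprSr invfM !mulrA -[_ * 1 / _]mulrA -len.
  pose t := (c + d) / 2.
  (* The indices of the two halves add up to 1, so exactly one half keeps index 1. *)
  have [Pct|Pct] := boolP (index P i (c, t)).
    exists (c, t); split=> //=; last by rewrite len' /t; lra.
    by apply/and3P; split=> /=; rewrite /t; lra.
  exists (t, d); split=> /=.
  - by apply/and3P; split=> /=; rewrite /t; lra.
  - by rewrite len' /t; lra.
  - move: Pcd Pct; rewrite /index /=.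
    by case: (P _ c) (P _ c) (P _ t) (P _ t) (P _ d) (P _ d) => -[] [] [] [] [].
have e'0 : 0 < e / (j.2 - j.1) by rewrite divr_gt0.
have [n _ /(_ n (leqnn _)) /= ltn] := near_infty_natSinv_expn_lt (PosNum e'0).
have [j' [nj len Pj]] := bisect n; exists j'; split=> //.
by rewrite len mulrC -ltr_pdivlMr.
Qed.

(* If both vertical edges stay on the side [s] of [p], only the horizontal edges
   contribute, each through its sign change at [q j.1], resp. [q j.2]. *)
Definition edge_rule {R : realType} (p q : R -> R) (P : R -> R -> bool) :=
  forall (s : bool) (i j : R * R), i.1 < i.2 -> j.1 < j.2 ->
  beyond s (p i.1) j -> beyond s (p i.2) j ->
  index P i j =
    ((s (+) (j.1 < p (q j.1))) && (i.1 < q j.1 < i.2)) (+)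
    ((s (+) (j.2 < p (q j.2))) && (i.1 < q j.2 < i.2)).

(** * Shrinking a rectangle towards the graph of a limit function *)

(** For fixed [y] the negation is a family of non-strict inequalities on [h n x], over all [n] from
    [m] on; it defines a closed set of [x] and passes to the limit. *)
Definition near_side {R : realType} (h : nat -> R -> R) (s : bool) (m : nat)
    (x y : R) :=
  exists2 n, (m <= n)%N &
    if s then h n x < y + m.+1%:R^-1 else y - m.+1%:R^-1 < h n x.

Lemma near_side_limit {R : realType} {h : nat -> R -> R} {x y l : R} :
  h n x @[n --> \oo] --> l -> (forall s m, near_side h s m x y) -> y = l.
Proof.
move=> hl near; apply/eqP; rewrite eq_le; apply/andP; split; rewrite leNgt;
  apply/negP => lt.
- have [k lk] := ltr_add_invr lt.
  have : l < y - k.+1%:R^-1 by rewrite ltrBrDr.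
  move=> /(cvgr_lt _ hl)[N _ hN].
  (* [N] makes [n] late enough for convergence; [k] makes the tolerance smaller than the gap between
     [l] and [y]. *)
  have [n mn] := near false (maxn N k).
  have := hN n (leq_trans (leq_maxl _ _) mn) => /= h1 h2.
  have := lt_trans h2 h1; rewrite ltrD2l ltrN2 ltNge => /negP; apply.
  by rewrite lef_pV2 ?posrE ?ltr0n // ler_nat ltnS leq_maxr.
- have [k lk] := ltr_add_invr lt.
  have : y + k.+1%:R^-1 < l by [].
  move=> /(cvgr_gt _ hl)[N _ hN].
  have [n mn] := near true (maxn N k).
  have := hN n (leq_trans (leq_maxl _ _) mn) => /= h1 h2.
  have := lt_trans h1 h2; rewrite ltrD2l ltNge => /negP; apply.
  by rewrite lef_pV2 ?posrE ?ltr0n // ler_nat ltnS leq_maxr.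
Qed.

Lemma index_near_side {R : realType} {p q : R -> R} {h : nat -> R -> R}
    {P : R -> R -> bool} (s : bool) (m : nat) {i j : R * R} :
  darboux `[0, 1] p -> (forall n, {within `[0, 1], continuous (h n)}) ->
  (forall x, `[0, 1]%classic x -> h n x @[n --> \oo] --> p x) -> edge_rule p q P ->
  nested i (0, 1) -> nested j (0, 1) -> index P i j ->
  exists i' j', [/\ nested i' i, nested j' j, index P i' j' &
    forall x y, i'.1 <= x <= i'.2 -> j'.1 <= y <= j'.2 -> near_side h s m x y].
Proof.
move=> dp hc hp rule ni nj Pij.
have /and3P[/= i0 ii i1] := ni; have /and3P[/= j0 jj j1] := nj.
pose e : R := m.+1%:R^-1; have e0 : 0 < e by rewrite invr_gt0 ltr0n.
have [[c d] [nj' /= thin Pij']] := index_thin e0 jj Pij.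
have /and3P[/= _ cd _] := nj'.
apply: contrapT => none.
(* Failure of [near_side] at any height in [[c, d]] implies this condition at the weakest height.
   Since [d - c < e], it still forces the limit strictly beyond [(c, d)]. *)
pose V := if s then [set v | c + e <= v] else [set v : R | v <= d - e].
pose K := [set` `[i.1, i.2]] `&`
  \bigcap_(n in [set n | (m <= n)%N]) (`[0, 1] `&` h n @^-1` V).
have cV : closed V.
  by rewrite /V; case: s {none V K}; [exact: closed_ge|exact: closed_le].
have cK : closed K.
  apply: closedI; first exact: interval_closed.
  apply: closed_bigI => n _; apply: closed_within_preimage => //.
  exact: interval_closed.
pose N := [set z | beyond s (p z) (c, d)].
have KAB x : K x -> i.1 <= x <= i.2 by case; rewrite /= in_itv.
have KN : K `<=` N.
  move=> x [_ Kx]; have [x01 _] := Kx m (leqnn m).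
  have cvg := hp x x01; rewrite /N /= /beyond /=.
  have near_V : \forall n \near \oo, V (h n x).
    by exists m => // n mn; exact: (Kx n mn).2.
  have : V (p x) by apply: (closed_cvg _ cV) cvg.
  by rewrite /V; case: (s) => /= ?; lra.
have sub01 (I : interval R) : [set` I] `<=` [set` `[i.1, i.2]] ->
    [set` I] `<=` `[0, 1].
  move=> sI x /sI /=; rewrite !in_itv /= => /andP[ix xi].
  by rewrite (le_trans i0) // (le_trans xi).
suff : P i.1 c (+) P i.1 d = P i.2 c (+) P i.2 d.
  move: Pij'; rewrite /index /=.
  by case: (P _ c) (P _ c) (P _ d) (P _ d) => -[] [] [].
apply: (@constant_across_gaps R i.1 i.2 K N (fun x => P x c (+) P x d)
  (q c) (q d) (s (+) (c < p (q c))) (s (+) (d < p (q d)))) => //.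
- move=> k x Kk ix xk; have /andP[_ ki] := KAB k Kk.
  have [||||||z [/=]] :=
    @darboux_beyond _ _ `]x, k] _ s (c, d) k ((x + k) / 2) dp.
  + exact: interval_is_interval.
  + by apply: sub01 => z /=; rewrite !in_itv /= => /andP[]; lra.
  + by rewrite /= in_itv /= xk lexx.
  + by rewrite /= in_itv /=; apply/andP; split; lra.
  + by apply/eqP; lra.
  + exact: KN.
  rewrite in_itv /= => /andP[xz zk] zk' Nz; exists z; split=> //.
  by rewrite lt_neqAle zk' zk.
- move=> k x Kk xi kx; have /andP[ik _] := KAB k Kk.
  have [||||||z [/=]] :=
    @darboux_beyond _ _ `[k, x[ _ s (c, d) k ((x + k) / 2) dp.
  + exact: interval_is_interval.
  + by apply: sub01 => z /=; rewrite !in_itv /= => /andP[]; lra.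
  + by rewrite /= in_itv /= kx lexx.
  + by rewrite /= in_itv /=; apply/andP; split; lra.
  + by apply/eqP; lra.
  + exact: KN.
  rewrite in_itv /= => /andP[kz zx] zk' Nz; exists z; split=> //.
  by rewrite lt_neqAle eq_sym zk' kz.
- move=> a b _ _ ab Na Nb; rewrite addbACA.
  exact: (rule s (a, b) (c, d)).
(* An effective sign change has [p] off the side [s] of its own edge, hence it is not in [N]. *)
- by rewrite /N /= /beyond; case: (s) => /=; [move=> /negP; lra|lra].
- by rewrite /N /= /beyond; case: (s) => /=; [move=> /negP; lra|lra].
(* A rectangle of index 1 over an interval avoiding [K] would be the one excluded by [none]. *)
move=> a b ia bi ab free; apply: contrapT => neq; apply: none.
exists (a, b), (c, d); split=> //; first by rewrite /nested /= ia ab.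
  move: neq; rewrite /index /=.
  by case: (P _ c) (P _ c) (P _ d) (P _ d) => -[] [] [].
move=> x y /= abx cdy; apply: contrapT => far; apply: (free x abx).
have [ax xb] := andP abx; split; first by rewrite /= in_itv /=; lra.
move=> n /= mn; split; first by rewrite /= in_itv /=; lra.
rewrite /V; case: (s) far => far /=; rewrite leNgt; apply/negP => lt;
  by apply: far; exists n => //=; rewrite -/e; lra.
Qed.

(** * The winding parity of the pair [f], [g] *)

(* The parity of the crossings of the ray [{g x - y = 0 < f y - x}] along the
   horizontal line at height [y], clipped at its sign change [f y], plus those
   along the vertical line at [x]. Only its mod 2 coboundary [index] matters. *)
Definition winding {R : realType} (f g : R -> R) (x y : R) : bool :=
  (y < g (Num.min x (f y))) (+) ((y < g x) && (x < f (g x))).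

Lemma beyond_lt {R : realType} {s : bool} {v c d : R} :
  c < d -> beyond s v (c, d) -> (c < v) = s /\ (d < v) = s.
Proof.
rewrite /beyond => cd; case: s => /= v_cd; first by rewrite v_cd (lt_trans cd).
by split; apply/negbTE; rewrite -leNgt ltW // (lt_trans v_cd).
Qed.

(** From [a] to [b] the clipped term changes only if [f y] lies in between, from [s] to
    [y < g (f y)]. The change of the other term does not depend on [y], so it cancels between the
    two horizontal edges. *)
Lemma winding_horizontal {R : realType} (f g : R -> R) :
  edge_rule g f (winding f g).
Proof.
move=> s [a b] [c d] /= ab cd sa sb.
have step y : (y < g a) = s -> (y < g b) = s ->
    winding f g a y (+) winding f g b y =
    (s (+) (y < g (f y))) && (a < f y < b) (+)
    (s && (a < f (g a)) (+) s && (b < f (g b))).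
  move=> ya yb; rewrite /winding ya yb.
  have [fa|af] := leP (f y) a.
    rewrite (min_idPr (le_trans fa (ltW ab))) /=.
    by rewrite andbF; case: (y < _) (_ < f _) (_ < f _) (s) => -[] [] [].
  have [bf|fb] := leP b (f y).
    by rewrite ya yb /= !andbF; case: (_ < f _) (_ < f _) (s) => -[] [].
  by rewrite ya; case: (y < _) (_ < f _) (_ < f _) (s) => -[] [] [].
have [[ca da] [cb db]] := (beyond_lt cd sa, beyond_lt cd sb).
rewrite /index /= !step //.
by case: (s && _ (+) _) (_ && (a < f c < b)) (_ && (a < f d < b)) => -[] [].
Qed.

(** At the corners the minimum is [x] if [s] holds and [f y] otherwise. Apart from the jump at
    [g x], what remains does not depend on [x] and cancels between the two vertical edges. *)
Lemma winding_vertical {R : realType} (f g : R -> R) :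
  edge_rule f g (fun y x => winding f g x y).
Proof.
move=> s [c d] [a b] /= cd ab sc sd.
have [/= [ac bc] [ad bd]] := (beyond_lt ab sc, beyond_lt ab sd).
have step x : (x < f c) = s -> (x < f d) = s ->
    winding f g x c (+) winding f g x d =
    (s (+) (x < f (g x))) && (c < g x < d) (+)
    (~~ s && (c < g (f c)) (+) ~~ s && (d < g (f d))).
  move=> xc xd; rewrite /winding /Num.min xc xd.
  have ifE y : (y < g (if s then x else f y)) =
      if s then y < g x else y < g (f y).
    by case: (s).
  rewrite !{}ifE.
  have [gc|cg] := leP (g x) c.
    rewrite (le_gtF (le_trans gc (ltW cd))) andbF.
    by case: (_ < g (f c)) (_ < g (f d)) (s) => -[] [].
  have [gd|dg|->] := ltgtP (g x) d.
  - by case: (x < _) (_ < g (f c)) (_ < g (f d)) (s) => -[] [] [].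
  - by case: (x < _) (_ < g (f c)) (_ < g (f d)) (s) => -[] [] [].
  (* If [g x = d], then [x < f (g x)] has truth value [s], so the endpoint contributes nothing, in
     accordance with the strict bounds. *)
  - by rewrite xd; case: (_ < g (f c)) (_ < g (f d)) (s) => -[] [].
rewrite /index /= !step //.
by case: (~~ s && _ (+) _) (_ && (c < g a < d)) (_ && (c < g b < d)) => -[] [].
Qed.

(** Only the corner [(1, 0)] counts. At height 1 both terms vanish; at the origin they cancel
    because [f (g 0)] is not 0. At [(1, 0)] there remains [0 < g (f 0)], as [g (f 0) = 0] would make
    [f 0] a fixed point. *)
Lemma index_winding_unit_square {R : realType} {f g : R -> R} :
  set_fun `[0, 1] `[0, 1] f -> set_fun `[0, 1] `[0, 1] g ->
  (forall x : R, x \in `[0, 1] -> f (g x) <> x) ->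
  index (winding f g) (0, 1) (0, 1).
Proof.
move=> f01 g01 nofix.
have bound (h : R -> R) (x : R) : set_fun `[0, 1] `[0, 1] h -> 0 <= x <= 1 ->
    0 <= h x <= 1.
  by move=> h01 x01; have := h01 x; rewrite /= !in_itv; exact.
have zero01 : 0 <= (0 : R) <= 1 by rewrite lexx ler01.
have one01 : 0 <= (1 : R) <= 1 by rewrite lexx ler01.
have top x : 0 <= x <= 1 -> winding f g x 1 = false.
  move=> x01; rewrite /winding.
  have /andP[_ /le_gtF ->] := bound g x g01 x01; rewrite addbF.
  have /andP[f0 f1] := bound f _ f01 one01; case/andP: x01 => x0 x1.
  apply: le_gtF; apply: (andP (bound g _ g01 _)).2.
  by rewrite le_min x0 f0 ge_min x1.
rewrite /index /= !top // addbF /winding.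
have /andP[f0 f1] := bound f _ f01 zero01.
rewrite (min_idPl f0) (min_idPr f1).
have -> : (0 < g 0) && (0 < f (g 0)) = (0 < g 0).
  rewrite [0 < f _]lt_def (andP (bound f _ f01 (bound g _ g01 zero01))).1 andbT.
  case: eqVneq => [fix0|]; last by rewrite andbT.
  by case: (nofix 0) => //; rewrite in_itv.
rewrite addbb /= [1 < _]le_gtF ?andbF ?addbF; last first.
  exact: (andP (bound f _ f01 (bound g _ g01 one01))).2.
rewrite lt_def (andP (bound g _ g01 (bound f _ f01 zero01))).1 andbT.
by apply/eqP => gf0; apply: (nofix (f 0)); rewrite ?gf0 // in_itv /= f0.
Qed.

(** * Nested rectangles and the conclusion *)

Lemma nested_intersection {R : realType} {i : nat -> R * R} :
  (forall n, nested (i n.+1) (i n)) ->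
  exists x, forall n, (i n).1 <= x <= (i n).2.
Proof.
move=> ni.
have lo : {homo (fun n => (i n).1) : m n / (m <= n)%N >-> m <= n}.
  by apply/nondecreasing_seqP => n; have /and3P[] := ni n.
have hi : {homo (fun n => (i n).2) : m n / (m <= n)%N >-> n <= m}.
  by apply/nonincreasing_seqP => n; have /and3P[] := ni n.
have lohi m n : (i m).1 <= (i n).2.
  have /and3P[l1 lt l2] := ni (maxn m n).
  rewrite (le_trans (lo _ _ (leq_maxl m n))) // (le_trans l1) //.
  by rewrite (le_trans (ltW lt)) // (le_trans l2) // hi ?leq_maxr.
exists (sup (range (fun n => (i n).1))) => n; apply/andP; split.
  apply: ub_le_sup; last by exists n.
  by exists (i 0%N).2 => _ [m _ <-].
apply: ge_sup; first by exists (i 0%N).1, 0%N.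
by move=> _ [m _ <-].
Qed.

Theorem corollary3 (R : realType) (f g : R -> R)
    (f01 : set_fun `[0, 1] `[0, 1] f) (g01 : set_fun `[0, 1] `[0, 1] g)
    (hf : darboux_baire1 `[0, 1] f) (hg : darboux_baire1 `[0, 1] g) :
  exists x : R, x \in `[0, 1] /\ f (g x) = x.
Proof.
have [df [hf_ [cf lf]]] := hf; have [dg [hg_ [cg lg]]] := hg.
apply: contrapT => nofix.
pose good (r : (R * R) * (R * R)) := [/\ nested r.1 (0, 1), nested r.2 (0, 1) &
  index (winding f g) r.1 r.2].
pose near m (r : (R * R) * (R * R)) := forall x y : R,
  r.1.1 <= x <= r.1.2 -> r.2.1 <= y <= r.2.2 -> forall s,
  near_side hg_ s m x y /\ near_side hf_ s m y x.
(* Four shrinkings in a row: both signs for [g], then both for [f] with the coordinates exchanged.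
   Passing to a smaller rectangle preserves what was gained before. *)
have refine m r : good r ->
    exists r', [/\ good r', nested r'.1 r.1, nested r'.2 r.2 & near m r'].
  case: r => i j [/= ni nj ij].
  have [i1 [j1 [ni1 nj1 ij1 S1]]] :=
    index_near_side true m dg cg lg (winding_horizontal f g) ni nj ij.
  have [i2 [j2 [ni2 nj2 ij2 S2]]] :=
    index_near_side false m dg cg lg (winding_horizontal f g)
      (nested_trans ni1 ni) (nested_trans nj1 nj) ij1.
  have ni20 := nested_trans ni2 (nested_trans ni1 ni).
  have nj20 := nested_trans nj2 (nested_trans nj1 nj).
  rewrite -index_transpose in ij2.
  have [j3 [i3 [nj3 ni3 ij3 S3]]] :=
    index_near_side true m df cf lf (winding_vertical f g) nj20 ni20 ij2.
  have [j4 [i4 [nj4 ni4 ij4 S4]]] :=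
    index_near_side false m df cf lf (winding_vertical f g)
      (nested_trans nj3 nj20) (nested_trans ni3 ni20) ij3.
  rewrite index_transpose in ij4.
  have ni42 := nested_trans ni4 ni3; have nj42 := nested_trans nj4 nj3.
  have ni41 := nested_trans ni42 ni2; have nj41 := nested_trans nj42 nj2.
  exists (i4, j4); split=> /=.
  - by split; [exact: nested_trans ni20|exact: nested_trans nj20|].
  - exact: nested_trans ni1.
  - exact: nested_trans nj1.
  have widen (k l : R * R) z : nested k l -> k.1 <= z <= k.2 -> l.1 <= z <= l.2.
    move=> /and3P[lk _ kl] /andP[kz zk].
    by rewrite (le_trans lk) // (le_trans zk).
  move=> x y xi yj [].
    by split; [apply: S1; [exact: widen xi|exact: widen yj]
              |apply: S3; [exact: widen yj|exact: widen xi]].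
  by split; [apply: S2; [exact: widen xi|exact: widen yj]|exact: S4].
have /choice[F HF] : forall mr, exists r', good mr.2 ->
    [/\ good r', nested r'.1 mr.2.1, nested r'.2 mr.2.2 & near mr.1 r'].
  move=> [m r]; have [/(refine m)[r' ?]|] := pselect (good r); first by exists r'.
  by move=> nr; exists r.
pose r := fix r n : (R * R) * (R * R) :=
  if n is m.+1 then F (m, r m) else ((0, 1), (0, 1)).
have rgood n : good (r n).
  elim: n => [|n /(HF (n, r n))[]//]; split; rewrite /nested /= ?lexx ?ltr01 //.
  apply: index_winding_unit_square => // x x01 fx; apply: nofix.
  by exists x.
have [|x xr] := @nested_intersection R (fun n => (r n).1).
  by move=> n; have [] := HF (n, r n) (rgood n).
have [|y yr] := @nested_intersection R (fun n => (r n).2).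
  by move=> n; have [] := HF (n, r n) (rgood n).
(* Precision [m] is reached in [r m.+1], the refinement of [r m]. *)
have sides s m : near_side hg_ s m x y /\ near_side hf_ s m y x.
  by have [_ _ _] := HF (m, r m) (rgood m); apply; [exact: xr m.+1|exact: yr m.+1].
have x01 := xr 0%N; have y01 := yr 0%N.
have yg := near_side_limit (lg x x01) (fun s m => (sides s m).1).
have xf := near_side_limit (lf y y01) (fun s m => (sides s m).2).
by apply: nofix; exists x; rewrite -yg.
Qed.
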